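(* Let $A$ and $B$ be Leibniz algebras over a field $\mathbb{F}$ and let $(\varphi,\varphi',f)$ be a factor system of $A$ by $B$. The following are equivalent: (a) $(\varphi,\varphi',f)$ splits; (b) $(\varphi,\varphi',f)$ is equivalent to some factor system $(\psi,\psi',g)$ of $A$ by $B$ such that $g=0$; (c) there exists a linear transformation $E:B\to A$ such that $f(i,j)=-\varphi'(j)E(i)-\varphi(i)E(j)-E(i)E(j)+E(ij)$ for all $i,j\in B$.
   Context: All algebras are vector spaces over a fixed field $\mathbb{F}$ with a bilinear multiplication (juxtaposition). A Leibniz algebra is an algebra satisfying $x(yz)=(xy)z+y(xz)$ for all $x,y,z$. $\mathcal{L}(A)$ is the space of linear maps $A\to A$, $\mathrm{Der}(A)\subseteq\mathcal{L}(A)$ the space of derivations ($D(mn)=D(m)n+mD(n)$), and $\mathrm{ad}^l_m n=mn$, $\mathrm{ad}^r_m n=nm$. A factor system of $A$ by $B$ is a tuple $(\varphi,\varphi',f)$ with $\varphi:B\to\mathrm{Der}(A)$ linear, $\varphi':B\to\mathcal{L}(A)$ linear, $f:B\times B\to A$ bilinear, such that for all $m,n\in A$, $i,j,k\in B$: (1) $m(\varphi(i)n)=(\varphi'(i)m)n+\varphi(i)(mn)$; (2) $m(\varphi'(i)n)=\varphi'(i)(mn)+n(\varphi'(i)m)$; (3) $\mathrm{ad}^r_{f(i,j)}+\varphi'(ij)=\varphi'(j)\varphi'(i)+\varphi(i)\varphi'(j)$; (4) $\varphi(i)(mn)=(\varphi(i)m)n+m(\varphi(i)n)$; (5) $\varphi(i)\varphi(j)=\varphi(ij)+\varphi(j)\varphi(i)+\mathrm{ad}^l_{f(i,j)}$;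 (6) $\varphi(i)\varphi'(j)=\varphi'(j)\varphi(i)+\varphi'(ij)+\mathrm{ad}^r_{f(i,j)}$; (7) $f(i,jk)+\varphi(i)f(j,k)=f(ij,k)+\varphi'(k)f(i,j)+f(j,ik)+\varphi(j)f(i,k)$. An extension of $A$ by $B$ is a short exact sequence $0\to A\xrightarrow{\sigma}L\xrightarrow{\pi}B\to0$ with $L$ a Leibniz algebra and $\sigma,\pi$ algebra homomorphisms. A section is a linear map $T:B\to L$ with $\pi T=I_B$. The extension splits if some section is an algebra homomorphism. For $x\in L$, $m\in A$ put $P(x)m=\sigma^{-1}(x\sigma(m))$ and $P'(x)m=\sigma^{-1}(\sigma(m)x)$. A factor system $(\varphi,\varphi',f)$ belongs to the extension and $T$ if $\varphi=PT$, $\varphi'=P'T$, and $\sigma(f(i,j))=T(i)T(j)-T(ij)$ for all $i,j\in B$. Every factor system belongs to an extension (and section), and any two extensions to which it belongs are equivalent, i.e. related by an algebra isomorphism $\tau$ of the middle terms with $\tau\sigma_1=\sigma_2$, $\pi_2\tau=\pi_1$; a factor system splits if the corresponding extension splits. Factor systems $(\varphi,\varphi',f)$ and $(\psi,\psi',g)$ of $A$ by $B$ are equivalent if there is a linear map $E:B\to A$ such that for all $i,j\in B$: $\psi(i)=\varphi(i)+\mathrm{ad}^l_{E(i)}$; $\psi'(i)=\varphi'(i)+\mathrm{ad}^r_{E(i)}$; $g(i,j)=f(i,j)+\varphi'(j)E(i)+\varphi(i)E(j)+E(i)E(j)-E(ij)$. *)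

(* Defs.v *)
From HB Require Import structures.
From mathcomp Require Import all_boot all_order all_algebra.

Set Implicit Arguments.
Unset Strict Implicit.
Unset Printing Implicit Defensive.

Import GRing.Theory.
Local Open Scope ring_scope.

(* Left Leibniz algebras, of arbitrary dimension; [lmul] is neither
   associative nor unital, so the ring structures do not apply. *)
HB.mixin Record Lmodule_isLeibniz (F : fieldType) L of GRing.Lmodule F L := {
  lmul : L -> L -> L;
  lmul_linearl : forall y : L, linear (lmul^~ y);
  lmul_linearr : forall x : L, linear (lmul x);
  lmul_leibniz : forall x y z : L,
    lmul x (lmul y z) = lmul (lmul x y) z + lmul y (lmul x z)
}.

#[short(type="leibnizAlgType")]
HB.structure Definition LeibnizAlg (F : fieldType) :=
  { L of Lmodule_isLeibniz F L & GRing.Lmodule F L }.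

Notation "x ** y" := (lmul x y) (at level 40, left associativity) : ring_scope.

Section LmulBilinear.
Variables (F : fieldType) (L : leibnizAlgType F).

Lemma lmul_is_bilinear : bilinear_for *:%R *:%R (@lmul F L).
Proof. by split=> x; [exact: lmul_linearl | exact: lmul_linearr]. Qed.

HB.instance Definition _ := bilinear_isBilinear.Build
  F L L L *:%R *:%R (@lmul F L) lmul_is_bilinear.

Definition ad_l (m n : L) : L := m ** n.
Definition ad_r (m n : L) : L := n ** m.

Definition derivation (D : L -> L) : Prop :=
  forall m n, D (m ** n) = D m ** n + m ** D n.

End LmulBilinear.

(* A linear map B -> L(A) is encoded as a bilinear map B x A -> A, and an
   identity between linear maps is stated pointwise. *)
Record factor_system (F : fieldType) (A B : leibnizAlgType F) := FactorSystem {
  fs_l : {bilinear B -> A -> A};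
  fs_r : {bilinear B -> A -> A};
  fs_c : {bilinear B -> B -> A};
  fs_der : forall i, derivation (fs_l i);
  fs_ax1 : forall i m n, m ** fs_l i n = fs_r i m ** n + fs_l i (m ** n);
  fs_ax2 : forall i m n, m ** fs_r i n = fs_r i (m ** n) + n ** fs_r i m;
  fs_ax3 : forall i j m,
    ad_r (fs_c i j) m + fs_r (i ** j) m
      = fs_r j (fs_r i m) + fs_l i (fs_r j m);
  fs_ax4 : forall i m n, fs_l i (m ** n) = fs_l i m ** n + m ** fs_l i n;
  fs_ax5 : forall i j m,
    fs_l i (fs_l j m)
      = fs_l (i ** j) m + fs_l j (fs_l i m) + ad_l (fs_c i j) m;
  fs_ax6 : forall i j m,
    fs_l i (fs_r j m)
      = fs_r j (fs_l i m) + fs_r (i ** j) m + ad_r (fs_c i j) m;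
  fs_ax7 : forall i j k,
    fs_c i (j ** k) + fs_l i (fs_c j k)
      = fs_c (i ** j) k + fs_r k (fs_c i j) + fs_c j (i ** k)
        + fs_l j (fs_c i k)
}.

Definition fs_equiv (F : fieldType) (A B : leibnizAlgType F)
    (p q : factor_system A B) : Prop :=
  exists E : {linear B -> A},
  [/\ forall i m, fs_l q i m = fs_l p i m + ad_l (E i) m,
      forall i m, fs_r q i m = fs_r p i m + ad_r (E i) m
    & forall i j, fs_c q i j = fs_c p i j + fs_r p j (E i) + fs_l p i (E j)
                               + E i ** E j - E (i ** j)].

Record extension (F : fieldType) (A B : leibnizAlgType F) := Extension {
  ext_mid : leibnizAlgType F;
  ext_inj : {linear A -> ext_mid};
  ext_proj : {linear ext_mid -> B};
  ext_injM : {morph ext_inj : m n / m ** n};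
  ext_projM : {morph ext_proj : x y / x ** y};
  ext_inj_inj : injective ext_inj;
  ext_exact : forall x, ext_proj x = 0 <-> exists m, ext_inj m = x;
  ext_proj_surj : forall b, exists x, ext_proj x = b
}.

Section ExtensionTheory.
Variables (F : fieldType) (A B : leibnizAlgType F) (X : extension A B).
Local Notation L := (ext_mid X).
Local Notation sigma := (ext_inj X).
Local Notation pi := (ext_proj X).

Lemma ext_preim_ex (x : L) : pi x = 0 -> exists m, sigma m == x.
Proof. by move=> /ext_exact[m <-]; exists m. Qed.

Definition ext_inv (x : L) (kx : pi x = 0) : A := xchoose (ext_preim_ex kx).

Lemma ext_invK (x : L) (kx : pi x = 0) : sigma (ext_inv kx) = x.
Proof. exact/eqP/(xchooseP (ext_preim_ex kx)). Qed.

Lemma ext_proj_inj m : pi (sigma m) = 0.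
Proof. by apply/ext_exact; exists m. Qed.

Lemma ext_ker_l (x : L) m : pi (x ** sigma m) = 0.
Proof. by rewrite ext_projM ext_proj_inj linear0r. Qed.

Lemma ext_ker_r (x : L) m : pi (sigma m ** x) = 0.
Proof. by rewrite ext_projM ext_proj_inj linear0l. Qed.

Definition ext_P (x : L) (m : A) : A := ext_inv (ext_ker_l x m).
Definition ext_P' (x : L) (m : A) : A := ext_inv (ext_ker_r x m).

Definition is_section (T : {linear B -> L}) : Prop := cancel T pi.

Definition ext_splits : Prop :=
  exists T : {linear B -> L}, is_section T /\ {morph T : i j / i ** j}.

Definition fs_belongs (p : factor_system A B) (T : {linear B -> L}) : Prop :=
  [/\ forall i m, fs_l p i m = ext_P (T i) m,
      forall i m, fs_r p i m = ext_P' (T i) m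
    & forall i j, sigma (fs_c p i j) = T i ** T j - T (i ** j)].

End ExtensionTheory.

(* The extension to which a factor system belongs is unique only up to
   equivalence, and splitting is invariant under equivalence. *)
Definition fs_splits (F : fieldType) (A B : leibnizAlgType F)
    (p : factor_system A B) : Prop :=
  exists (X : extension A B) (T : {linear B -> ext_mid X}),
    [/\ is_section T, fs_belongs p T & ext_splits X].

(* Main.v *)
Require Import Defs.
From HB Require Import structures.
From mathcomp Require Import all_boot all_order all_algebra.

(** A splitting of an extension is a section T of it with zero cocycle, and
any two sections T and S differ by a linear map E from B to A, namely
sigma (E i) = S i - T i.  The factor systems read off from T and S are then
equivalent through E, so being split, being equivalent to a factor system with
zero cocycle, and the vanishing of the E-translate of the cocycle f are three
ways to say that some section is multiplicative.

To make this precise one needs to pass between sections and factor systems in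
both directions.  Every section defines a factor system
([section_factor_system]): its seven axioms are the Leibniz identity of the
middle algebra L, evaluated on triples taken from the images of A and of the
section.  Two sections of the same extension give equivalent factor systems
([section_equiv]).  Conversely a factor system defines a Leibniz
product on A * B ([crossed_leibniz]), which is an extension with section
i |-> (0, i) to which the factor system belongs ([crossed_belongs]).  In this
extension i |-> (E i, i) is a section for every linear E, and the formula for f
in terms of E says that this section is multiplicative
([crossed_section_morph]). *)

Import GRing.Theory.
Local Open Scope ring_scope.

Set Implicit Arguments.
Unset Strict Implicit.
Unset Printing Implicit Defensive.

(** * From sections to factor systems *)

Section SectionFactorSystem.
Variables (F : fieldType) (A B : leibnizAlgType F) (X : extension A B).
Local Notation L := (ext_mid X).
Local Notation sigma := (ext_inj X).
Local Notation pi := (ext_proj X).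

Lemma ext_PE (x : L) m : sigma (ext_P x m) = x ** sigma m.
Proof. exact: ext_invK. Qed.

Lemma ext_P'E (x : L) m : sigma (ext_P' x m) = sigma m ** x.
Proof. exact: ext_invK. Qed.

Section OneSection.
Variables (T : {linear B -> L}) (TK : is_section T).

Definition section_l (i : B) (m : A) : A := ext_P (T i) m.
Definition section_r (i : B) (m : A) : A := ext_P' (T i) m.

Lemma section_cocycle_ker i j : pi (T i ** T j - T (i ** j)) = 0.
Proof. by rewrite linearB /= ext_projM !TK subrr. Qed.

Definition section_c (i j : B) : A := ext_inv (section_cocycle_ker i j).

Lemma section_cE i j : sigma (section_c i j) = T i ** T j - T (i ** j).
Proof. exact: ext_invK. Qed.

Let sectionE := (ext_PE, ext_P'E, section_cE).

Lemma section_l_bilinear : bilinear_for *:%R *:%R section_l.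
Proof.
by split=> x a u v; apply: (@ext_inj_inj _ _ _ X);
  rewrite linearP /= !ext_PE linearP /= ?linearPl ?linearPr.
Qed.

Lemma section_r_bilinear : bilinear_for *:%R *:%R section_r.
Proof.
by split=> x a u v; apply: (@ext_inj_inj _ _ _ X);
  rewrite linearP /= !ext_P'E linearP /= ?linearPl ?linearPr.
Qed.

Lemma section_c_bilinear : bilinear_for *:%R *:%R section_c.
Proof.
split=> x a u v; apply: (@ext_inj_inj _ _ _ X); rewrite linearP /= !section_cE.
  by rewrite linearP !linearPl linearP scalerBr opprD addrACA.
by rewrite linearP !linearPr linearP scalerBr opprD addrACA.
Qed.

HB.instance Definition _ := bilinear_isBilinear.Build
  F B A A *:%R *:%R section_l section_l_bilinear.
HB.instance Definition _ := bilinear_isBilinear.Build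
  F B A A *:%R *:%R section_r section_r_bilinear.
HB.instance Definition _ := bilinear_isBilinear.Build
  F B B A *:%R *:%R section_c section_c_bilinear.

(** Injectivity of sigma turns each axiom into an instance of the Leibniz
identity of L; the cocycle terms account for the difference between
T (i ** j) and T i ** T j. *)
Definition section_factor_system : factor_system A B.
Proof.
apply: (@FactorSystem F A B section_l section_r section_c) => [i m n|i m n|i m n
  |i j m|i m n|i j m|i j m|i j k];
  apply: (@ext_inj_inj _ _ _ X); rewrite ?linearD /= /ad_l /ad_r ?sectionE
  ?ext_injM ?sectionE ?ext_injM ?sectionE.
- exact: lmul_leibniz.
- exact: lmul_leibniz.
- exact: lmul_leibniz.
- by rewrite linearBr subrK; exact: lmul_leibniz.
- exact: lmul_leibniz.
- rewrite linearBl addrAC subrKC; exact: lmul_leibniz.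
- rewrite linearBr -addrA subrKC; exact: lmul_leibniz.
(* The terms T i ** T (j ** k) and their permutations cancel; what remains is
   the Leibniz identity of L minus the image under T of that of B. *)
- rewrite !linearBr linearBl addrC subrKA -addrA [_ - T (i ** j ** k) + _]addrC.
  rewrite subrKA [_ - T (j ** (i ** k)) + _]addrC subrKA.
  by rewrite /= (lmul_leibniz (T i)) (lmul_leibniz i) linearD opprD addrACA.
Defined.

End OneSection.

Section TwoSections.
Variables (T S : {linear B -> L}).
Hypotheses (TK : is_section T) (SK : is_section S).

Lemma section_diff_ker i : pi (S i - T i) = 0.
Proof. by rewrite linearB /= TK SK subrr. Qed.

Definition section_diff (i : B) : A := ext_inv (section_diff_ker i).

Lemma section_diffE i : sigma (section_diff i) = S i - T i.
Proof. exact: ext_invK. Qed.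

Lemma section_diff_linear : linear section_diff.
Proof.
move=> a u v; apply: (@ext_inj_inj _ _ _ X).
by rewrite linearP /= !section_diffE !linearP scalerDr addrACA.
Qed.

HB.instance Definition _ :=
  GRing.isLinear.Build F B A *:%R section_diff section_diff_linear.

(** Substituting S i = T i + sigma (E i) in the defining formulas of the factor
system of S gives the three equations of an equivalence through E. *)
Lemma section_equiv (p : factor_system A B) :
  fs_belongs p T -> fs_equiv p (section_factor_system SK).
Proof.
move=> [pl pr pc]; exists section_diff.
have SE i : S i = T i + sigma (section_diff i) by rewrite section_diffE subrKC.
split=> [i m|i m|i j]; apply: (@ext_inj_inj _ _ _ X).
- by rewrite linearD /= ext_PE pl ext_PE ext_injM SE linearDl.
- by rewrite linearD /= ext_P'E pr ext_P'E ext_injM SE linearDr.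
rewrite linearB !linearD /= section_cE pc pl pr ext_PE ext_P'E ext_injM.
rewrite !SE !(linearDl, linearDr) /= opprD !addrA.
by rewrite [LHS](ACl (1*5*3*2*4*6)).
Qed.

End TwoSections.
End SectionFactorSystem.

(** * From factor systems to extensions *)

Section CrossedProduct.
Variables (F : fieldType) (A B : leibnizAlgType F) (p : factor_system A B).

(** The factor system is a phantom argument of the carrier: the product on
A * B depends on it. *)
Definition crossed (q : factor_system A B) : Type := (A * B)%type.
Local Notation L := (crossed p).

HB.instance Definition _ := GRing.Lmodule.copy L (A * B)%type.

(** The product forced by x = sigma x.1 + T x.2 in an extension to which p
belongs. *)
Definition crossed_mul (x y : L) : L :=
  (x.1 ** y.1 + fs_l p x.2 y.1 + fs_r p y.2 x.1 + fs_c p x.2 y.2, x.2 ** y.2).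

Lemma crossed_mul_linearl y : linear (crossed_mul^~ y).
Proof.
move=> a u v; congr (_, _); last exact: linearPl.
by rewrite /= linearPr !linearPl !scalerDr !addrA [LHS](ACl (1*3*5*7*2*4*6*8)).
Qed.

Lemma crossed_mul_linearr x : linear (crossed_mul x).
Proof.
move=> a u v; congr (_, _); last exact: linearPr.
by rewrite /= linearPl !linearPr !scalerDr !addrA [LHS](ACl (1*3*5*7*2*4*6*8)).
Qed.

(** The identity is trilinear, so it decomposes according to whether each of
the three arguments lies in A or in B: on A, A, A it is the Leibniz identity of
A, and the other seven cases are axioms of the factor system. *)
Lemma crossed_leibniz x y z :
  crossed_mul x (crossed_mul y z)
    = crossed_mul (crossed_mul x y) z + crossed_mul y (crossed_mul x z).
Proof.
case: x y z => [a i] [b j] [c k]; congr (_, _); last exact: lmul_leibniz.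
rewrite /= !(linearDl, linearDr) /= !addrA.
(* In this order the terms of the left-hand side are the left-hand sides of the
   Leibniz identity of A and of fs_ax1, 2, 4, 5, 6, 3 and 7. *)
rewrite [LHS](ACl (1*2*3*5*6*7*(4*9)*(10*8)))/=.
rewrite lmul_leibniz fs_ax1 fs_ax2 (fs_ax4 p i) fs_ax5 fs_ax6.
rewrite (fs_ax3 p j k a : a ** fs_c p j k + _ = _) fs_ax7 /ad_l /ad_r !addrA.
by rewrite [LHS](ACl (1*7*3*11*9*5*12*15*18*17*2*8*6*14*4*10*16*20*13*19)).
Qed.

HB.instance Definition _ := Lmodule_isLeibniz.Build
  F L crossed_mul_linearl crossed_mul_linearr crossed_leibniz.

Definition crossed_inj (m : A) : L := (m, 0).
Definition crossed_proj (x : L) : B := x.2.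

Lemma crossed_inj_linear : linear crossed_inj.
Proof. by move=> a u v; congr (_, _); rewrite /= scaler0 addr0. Qed.

Lemma crossed_proj_linear : linear crossed_proj.
Proof. by []. Qed.

HB.instance Definition _ :=
  GRing.isLinear.Build F A L *:%R crossed_inj crossed_inj_linear.
HB.instance Definition _ :=
  GRing.isLinear.Build F L B *:%R crossed_proj crossed_proj_linear.

Definition crossed_extension : extension A B.
Proof.
apply: (@Extension F A B L crossed_inj crossed_proj) => [m n|//|m n [] //|x|b].
- congr (_, _); last by rewrite linear0r.
  by rewrite /= !linear0l !addr0.
- split=> [|[m <-] //]; case: x => m i /= ->; by exists m.
- by exists (0, b).
Defined.

Definition crossed_section (E : B -> A) (i : B) : L := (E i, i).

Section CrossedSection.
Variable E : {linear B -> A}.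

Lemma crossed_section_linear : linear (crossed_section E).
Proof. by move=> a u v; congr (_, _); rewrite linearP. Qed.

HB.instance Definition _ :=
  GRing.isLinear.Build F B L *:%R (crossed_section E) crossed_section_linear.

End CrossedSection.

(** The factor system is recovered from its extension through the section
i |-> (0, i). *)
Lemma crossed_belongs :
  @fs_belongs F A B crossed_extension p (crossed_section (\0 : {linear B -> A})).
Proof.
split=> [i m|i m|i j]; try apply: (@ext_inj_inj _ _ _ crossed_extension).
- rewrite ext_PE; congr (_, _); last by rewrite linear0r.
  by rewrite /= linear0l !linear0r add0r !addr0.
- rewrite ext_P'E; congr (_, _); last by rewrite linear0l.
  by rewrite /= linear0r !linear0l !add0r addr0.
- congr (_, _); last by rewrite /= subrr.
  by rewrite /= linear0l !linear0r !add0r subr0.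
Qed.

(** The product of (E i, i) and (E j, j) has first component
E i ** E j + fs_l i (E j) + fs_r j (E i) + fs_c i j. *)
Lemma crossed_section_morph (E : {linear B -> A}) :
  (forall i j, fs_c p i j = - fs_r p j (E i) - fs_l p i (E j) - E i ** E j
                            + E (i ** j)) ->
  {morph crossed_section E : i j / i ** j}.
Proof.
move=> pE i j; congr (_, _); rewrite /= pE -!opprD.
by rewrite [X in _ = X + _](ACl (3*2*1)) addNKr.
Qed.

End CrossedProduct.

Theorem theorem3p7 (F : fieldType) (A B : leibnizAlgType F)
    (p : factor_system A B) :
  [<-> fs_splits p;
       exists q : factor_system A B,
         fs_equiv p q /\ (forall i j : B, fs_c q i j = 0);
       exists E : {linear B -> A}, forall i j : B,
         fs_c p i j = - fs_r p j (E i) - fs_l p i (E j) - E i ** E j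
                      + E (i ** j)].
Proof.
tfae=> [[X [T [TK pT [S [SK SM]]]]]|[q [[E [_ _ qE]] q0]]|[E pE]].
- exists (section_factor_system SK); split; first exact: section_equiv.
  move=> i j; apply: (@ext_inj_inj _ _ _ X).
  by rewrite /= section_cE SM subrr linear0.
- exists E => i j; have /esym/eqP := qE i j.
  rewrite q0 subr_eq add0r => /eqP <-.
  by rewrite -!opprD -!addrA [RHS]addrC addrK.
- exists (crossed_extension p), (crossed_section p (\0 : {linear B -> A})).
  split=> //; first exact: crossed_belongs.
  exists (crossed_section p E); split=> //; exact: crossed_section_morph.
Qed.
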